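(* Let $k\ge1$. The probability mass function $g_n^{(I)}(x)=P(N_n^{(I)}=x)$ satisfies, for $n\ge k+2$, the recursive scheme $$\begin{aligned}g_{n}^{(I)}(x)=&\,(\alpha+\beta)g_{n-1}^{(I)}(x)+(1-\alpha-\beta)g_{n-2}^{(I)}(x)+\alpha^{k}g_{n-k}^{(I)}(x-1)\\&-\alpha^{k-1}(1-\alpha)(1-\beta)g_{n-k-1}^{(I)}(x)+\alpha^{k-1}(1-\alpha-\beta-\alpha^{2})g_{n-k-1}^{(I)}(x-1)\\&-\alpha^{k}(1-\alpha-\beta)g_{n-k-2}^{(I)}(x-1).\end{aligned}$$
   Context: $(X_i)_{i\ge1}$ is an infinite sequence of two-state ($0$/$1$) Markov dependent Bernoulli trials (a time-homogeneous Markov chain) with $P(X_i=1)=p$, $P(X_i=0)=1-p=q$, and, for $i>1$, $P(X_i=1\mid X_{i-1}=1)=\alpha$ and $P(X_i=0\mid X_{i-1}=0)=\beta$. $N_n^{(I)}$ is the number of success runs of length $k$ in the first $n$ trials under non-overlapping counting (scanning left to right, each time $k$ consecutive ones are completed a run is counted and the counting of ones starts anew); $N_0^{(I)}=0$. Conventions: $x$ is a nonnegative integer and $g_n^{(I)}(x)=0$ for $x<0$; $\alpha^0=1$. *)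

(* Defs.v *)
From HB Require Import structures.
From mathcomp Require Import all_boot all_order all_algebra.
From mathcomp Require Import all_classical all_reals all_analysis.

Set Implicit Arguments.
Unset Strict Implicit.
Unset Printing Implicit Defensive.

Import Order.TTheory GRing.Theory Num.Theory.
Local Open Scope classical_set_scope.
Local Open Scope ring_scope.

Definition prob {R : realType} {d : measure_display} {T : measurableType d}
  (P : probability T R) (A : set T) : R := fine (P A).

(* Meaningful only when [prob P B] is nonzero. *)
Definition cond_prob {R : realType} {d : measure_display} {T : measurableType d}
  (P : probability T R) (A B : set T) : R := prob P (A `&` B) / prob P B.

(* Success is [true], failure is [false]. Trials are numbered from 0: [X i] is
   the (i+1)-st trial. Conditional probabilities are constrained only when the
   conditioning event has positive probability; a transition probability out of
   a state that is never visited is an arbitrary element of [0, 1]. *)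
Record markov_bernoulli_trials {R : realType} {d : measure_display}
    {T : measurableType d} (P : probability T R) (X : nat -> {RV P >-> bool})
    (p alpha beta : R) : Prop := MarkovBernoulliTrials {
  mbt_alpha : 0 <= alpha <= 1;
  mbt_beta : 0 <= beta <= 1;
  mbt_success : forall i : nat, prob P [set w | X i w = true] = p;
  mbt_failure : forall i : nat, prob P [set w | X i w = false] = 1 - p;
  mbt_markov : forall (i : nat) (h : nat -> bool) (b : bool),
    0 < prob P [set w | forall j : nat, (j <= i)%N -> X j w = h j] ->
    cond_prob P [set w | X i.+1 w = b]
                [set w | forall j : nat, (j <= i)%N -> X j w = h j] =
    cond_prob P [set w | X i.+1 w = b] [set w | X i w = h i];
  mbt_trans11 : forall i : nat, 0 < prob P [set w | X i w = true] ->
    cond_prob P [set w | X i.+1 w = true] [set w | X i w = true] = alpha;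
  mbt_trans00 : forall i : nat, 0 < prob P [set w | X i w = false] ->
    cond_prob P [set w | X i.+1 w = false] [set w | X i w = false] = beta
}.

(* Left-to-right scan of [s]; [c] is the number of consecutive successes seen
   since the last failure or the last counted run. *)
Fixpoint count_runs_from (k c : nat) (s : seq bool) : nat :=
  match s with
  | [::] => 0%N
  | true :: s' => if c.+1 == k then (count_runs_from k 0 s').+1
                  else count_runs_from k c.+1 s'
  | false :: s' => count_runs_from k 0 s'
  end.

Definition count_runs (k : nat) (s : seq bool) : nat := count_runs_from k 0 s.

Definition num_runs {R : realType} {d : measure_display} {T : measurableType d}
    (P : probability T R) (X : nat -> {RV P >-> bool}) (k n : nat) (w : T) :
    nat :=
  count_runs k [seq X i w | i <- iota 0 n].

(* The argument [x] is an integer so that the value is 0 for [x < 0]. *)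
Definition runs_pmf {R : realType} {d : measure_display} {T : measurableType d}
    (P : probability T R) (X : nat -> {RV P >-> bool}) (k n : nat) (x : int) :
    R :=
  prob P [set w | (num_runs X k n w)%:Z = x].

(* Main.v *)
(* By the Markov property the law of the count depends on the past only through
   the last trial and the counter of the scan. Let F, S and T be the laws of the
   count in m further trials after a failure, after a completed run, and after a
   success that sets the counter to 1. Telescoping over the first failure gives
   T(m+k) in terms of T(m+k-1), F(m+k-1), F(m) and S(m+1), S(m), the last two
   shifted by one run; this closes a linear system with the one-step equations
   of F and S. The pmf G = (1 - p) F + p T (one step delayed) satisfies the
   recursion as a linear combination of these equations, also at m = 0, since
   (1 - alpha - beta) (G - S) = (p - alpha) (F - S) holds there too. *)
Require Import Defs.
From HB Require Import structures.
From mathcomp Require Import all_boot all_order all_algebra.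
From mathcomp Require Import all_classical all_reals all_analysis.
From mathcomp Require Import ring zify.
Import Order.TTheory GRing.Theory Num.Theory.
Local Open Scope ring_scope.

(* Law of the number of runs completed in [m] further trials, given the last
   trial [b] and the current counter [c]. *)
Fixpoint run_law {R : realType} (alpha beta : R) (k : nat) (b : bool) (c m : nat)
    (y : int) : R :=
  match m with
  | 0 => (y == 0)%:R
  | m'.+1 =>
    (if b then 1 - alpha else beta) * run_law alpha beta k false 0 m' y
    + (if b then alpha else 1 - beta)
      * (if c.+1 == k then run_law alpha beta k true 0 m' (y - 1)
         else run_law alpha beta k true c.+1 m' y)
  end.

(* A counter [c] equal to [k] encodes a run completed by the last trial. *)
Definition success_law {R : realType} (alpha beta : R) (k c m : nat) (y : int) : R :=
  if c == k then run_law alpha beta k true 0 m (y - 1)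
  else run_law alpha beta k true c m y.

(** A first success passes through [success_law] because it already completes a run when [k = 1]. *)
Definition initial_law {R : realType} (alpha beta p : R) (k m : nat) (y : int) : R :=
  match m with
  | 0 => (y == 0)%:R
  | m'.+1 => (1 - p) * run_law alpha beta k false 0 m' y
             + p * success_law alpha beta k 1 m' y
  end.

(** * Linear recursions between the run laws *)

Section Recursion.
Context {R : realType} (alpha beta : R) (k : nat).
Local Notation F := (run_law alpha beta k false 0).
Local Notation S0 := (run_law alpha beta k true 0).
Local Notation T := (success_law alpha beta k).

Lemma run_lawS b c m y :
  run_law alpha beta k b c m.+1 y =
  (if b then 1 - alpha else beta) * F m y
  + (if b then alpha else 1 - beta) * T c.+1 m y.
Proof. by []. Qed.

(* Multiplying the generating function in [m] by [1 - alpha * z] telescopes the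
   sum over the position of the first failure. *)
Lemma success_law_telescope e c m y : (c + e = k)%N ->
  T c (m + e).+1 y - alpha * T c (m + e)%N y =
  (1 - alpha) * (F (m + e)%N y - alpha ^+ e * F m y)
  + alpha ^+ e * (S0 m.+1 (y - 1) - alpha * S0 m (y - 1)).
Proof.
elim: e c => [|e IH] c.
  rewrite addn0 => ->; rewrite /success_law eqxx addn0 expr0; ring.
move=> ce; have ck : (c == k) = false by apply/negbTE/eqP; lia.
have := IH c.+1; rewrite addSnnS => /(_ ce) {}IH.
rewrite addnS {1 2}/success_law ck !(run_lawS true c) exprS.
(* Both values of [T c] are expanded over the next trial; the term in [F (m + e)] then cancels
   against the one from the induction hypothesis. *)
transitivity ((1 - alpha) * (F (m + e).+1 y - alpha * F (m + e)%N y)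
  + alpha * (T c.+1 (m + e).+1 y - alpha * T c.+1 (m + e)%N y)); first ring.
rewrite IH; ring.
Qed.

(* Both sides vanish at [m = 0]; for [m > 0] the three laws are the mixtures of
   [F] and [T 1] with weights [p], [1 - beta] and [alpha] on [T 1]. *)
Lemma initial_law_interpolation p m y :
  (1 - alpha - beta) * (initial_law alpha beta p k m y - S0 m y) =
  (p - alpha) * (F m y - S0 m y).
Proof. by case: m => [|m]; rewrite ?run_lawS /=; ring. Qed.

Lemma initial_law_rec p m y : (0 < k)%N ->
  let G := initial_law alpha beta p k in
  G (m + k).+2 y =
    (alpha + beta) * G (m + k).+1 y + (1 - alpha - beta) * G (m + k)%N y
    + alpha ^+ k * G m.+2 (y - 1)
    - alpha ^+ (k - 1) * (1 - alpha) * (1 - beta) * G m.+1 y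
    + alpha ^+ (k - 1) * (1 - alpha - beta - alpha ^+ 2) * G m.+1 (y - 1)
    - alpha ^+ k * (1 - alpha - beta) * G m (y - 1).
Proof.
move=> k0 G; set e := (k - 1)%N.
have ke : (1 + e = k)%N by rewrite /e; lia.
(* After one success, [e] more complete a run. Two consecutive instances eliminate the two highest
   values of [T 1]. *)
have E1 := success_law_telescope e 1 m y ke.
have E2 := success_law_telescope e 1 m.+1 y ke.
have I := initial_law_interpolation p m (y - 1).
have -> : (m + k = (m + e).+1)%N by lia.
have -> : alpha ^+ k = alpha * alpha ^+ e by rewrite -ke exprD expr1.
(* For a variable [m], [G m] does not unfold; it is grouped with its factor [1 - alpha - beta] and
   eliminated by interpolation. *)
rewrite -[alpha * _ * (1 - _ - _) * _]mulrA.
have -> : (1 - alpha - beta) * G m (y - 1) =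
  (1 - alpha - beta) * S0 m (y - 1) + (p - alpha) * (F m (y - 1) - S0 m (y - 1)).
  rewrite -I /G; ring.
rewrite addSn in E2.
move: E1 E2 => /(canRL (subrK _)) E1 /(canRL (subrK _)) E2.
rewrite /G /initial_law E2 !(run_lawS false) E1 !run_lawS; ring.
Qed.

End Recursion.

(** * Probabilities of finite histories of the chain *)

Section Chain.
Context {R : realType} {d : measure_display} {T : measurableType d}.
Variables (P : probability T R) (X : nat -> {RV P >-> bool}).

Local Open Scope classical_set_scope.

Definition history (i : nat) (h : nat -> bool) : set T :=
  [set w | forall j, (j <= i)%N -> X j w = h j].

Lemma measurable_trial i b : measurable [set w | X i w = b].
Proof. exact: (measurable_funPTI (X i) (Y := [set b])). Qed.

(** Splitting on the first listed trial leaves a predicate on fewer bits, so [g] can be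
    arbitrary. *)
Lemma measurable_trials (s : seq nat) (g : seq bool -> Prop) :
  measurable [set w | g [seq X j w | j <- s]].
Proof.
elim: s g => [|i s IH] g /=.
  case: (pselect (g [::])) => gnil.
    by rewrite (_ : [set _ | _] = setT)//; apply/seteqP; split.
  by rewrite (_ : [set _ | _] = set0)//; apply/seteqP; split.
rewrite (_ : [set _ | _] =
    ([set w | X i w = true] `&` [set w | g (true :: [seq X j w | j <- s])])
    `|` ([set w | X i w = false] `&` [set w | g (false :: [seq X j w | j <- s])])).
  apply: measurableU; apply: measurableI; try exact: measurable_trial.
    exact: (IH (fun t => g (true :: t))).
  exact: (IH (fun t => g (false :: t))).
apply/seteqP; split=> w /=; last by case=> -[->].
by case: (X i w) => ?; [left|right].
Qed.

Lemma measurable_history i h : measurable (history i h).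
Proof.
rewrite (_ : history i h =
  [set w | [seq X j w | j <- iota 0 i.+1] = [seq h j | j <- iota 0 i.+1]]).
  exact: (measurable_trials (iota 0 i.+1) (fun t => t = [seq h j | j <- iota 0 i.+1])).
apply/seteqP; split=> w H.
  by apply/eq_in_map => j; rewrite mem_iota => ji; apply: H; lia.
by move=> j ji; apply: (iffRL (eq_in_map _ _ _) H); rewrite mem_iota; lia.
Qed.

Lemma prob_split (A : set T) i : measurable A ->
  prob P A = prob P (A `&` [set w | X i w = false])
             + prob P (A `&` [set w | X i w = true]).
Proof.
move=> mA; have mt := measurable_trial i true; have mf := measurable_trial i false.
rewrite /prob -fineD ?fin_num_measure//; try exact: measurableI.
rewrite -measureU; [|exact: measurableI|exact: measurableI|].
  congr (fine (P _)); apply/seteqP; split=> w /=; last by case=> -[].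
  by case: (X i w) => ?; [right|left].
by apply/seteqP; split=> w //= [[_ ->] []].
Qed.

Lemma le_prob (A B : set T) : measurable A -> measurable B -> A `<=` B ->
  prob P A <= prob P B.
Proof.
move=> mA mB AB; apply: fine_le; rewrite ?fin_num_measure//.
by apply: le_measure; rewrite ?inE.
Qed.

Context {p alpha beta : R}.
Hypothesis HX : markov_bernoulli_trials X p alpha beta.

(** The two conditional probabilities out of a state sum to 1, so [alpha] and [beta] fix all four
    transitions. *)
Lemma cond_prob_next i b b' : 0 < prob P [set w | X i w = b] ->
  cond_prob P [set w | X i.+1 w = b'] [set w | X i w = b] =
  if b' then (if b then alpha else 1 - beta) else (if b then 1 - alpha else beta).
Proof.
move=> b_gt0.
have : cond_prob P [set w | X i.+1 w = false] [set w | X i w = b]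
       + cond_prob P [set w | X i.+1 w = true] [set w | X i w = b] = 1.
  rewrite /cond_prob -mulrDl ![_ `&` [set w | X i w = b]]setIC -prob_split.
    by rewrite divff// gt_eqF.
  exact: measurable_trial.
case: b b_gt0 => b_gt0.
  have := mbt_trans11 HX b_gt0; case: b' => // -> <-; ring.
have := mbt_trans00 HX b_gt0; case: b' => // -> <-; ring.
Qed.

Lemma prob_history_next i h b :
  prob P (history i h `&` [set w | X i.+1 w = b]) =
  prob P (history i h) *
  if b then (if h i then alpha else 1 - beta) else (if h i then 1 - alpha else beta).
Proof.
have mh := measurable_history i h.
have mn := measurableI _ _ mh (measurable_trial i.+1 b).
have prob_ge0 A : 0 <= prob P A by rewrite fine_ge0.
(* The Markov property says nothing about a null history, but then both sides vanish. *)
have [h0|h_neq0] := eqVneq (prob P (history i h)) 0.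
  rewrite h0 mul0r; apply/le_anti/andP; split=> //.
  by rewrite -[X in _ <= X]h0; apply: le_prob => // w [].
have h_gt0 : 0 < prob P (history i h) by rewrite lt0r h_neq0 prob_ge0.
have X_gt0 : 0 < prob P [set w | X i w = h i].
  apply: lt_le_trans h_gt0 _; apply: le_prob => //; first exact: measurable_trial.
  by move=> w; apply.
rewrite -(cond_prob_next _ _ b X_gt0) -(mbt_markov HX b h_gt0) /cond_prob.
by rewrite setIC mulrC divfK.
Qed.

Lemma history_next i h b :
  history i h `&` [set w | X i.+1 w = b] =
  history i.+1 (fun j => if (j <= i)%N then h j else b).
Proof.
apply/seteqP; split=> w /=.
  move=> [H Hb] j; rewrite leq_eqVlt ltnS => /orP[/eqP ->|ji].
    by rewrite ltnn.
  by rewrite ji H.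
move=> H; split; last by rewrite H// ltnn.
by move=> j ji; rewrite H ?ji//; lia.
Qed.

(** Induction on [m] over all histories, splitting on trial [i.+1]. The product form, unlike a
    conditional probability, also covers null histories. *)
Lemma prob_history_runs k m i h c (y : int) :
  prob P (history i h `&`
    [set w | (count_runs_from k c [seq X j w | j <- iota i.+1 m])%:Z = y]) =
  prob P (history i h) * run_law alpha beta k (h i) c m y.
Proof.
elim: m i h c y => [|m IH] i h c y.
  rewrite /=; have [->|y0] := eqVneq y 0.
    rewrite (_ : [set _ | _] = setT) ?setIT ?mulr1//.
    by apply/seteqP; split.
  rewrite (_ : [set _ | _] = set0) ?setI0 ?mulr0 /prob ?measure0//.
  by apply/seteqP; split=> // w /= /esym/eqP; rewrite (negbTE y0).
rewrite (prob_split _ i.+1); last first.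
  apply: measurableI; first exact: measurable_history.
  by apply: (measurable_trials (iota i.+1 m.+1)
    (fun s => (count_runs_from k c s)%:Z = y)).
(* Reading [b] extends the history by one trial and turns counter [c] and target [y] into [c'] and
   [y']. *)
have swap b c' y' :
    (forall s, (count_runs_from k c (b :: s))%:Z = y <->
               (count_runs_from k c' s)%:Z = y') ->
    history i h
      `&` [set w | (count_runs_from k c [seq X j w | j <- iota i.+1 m.+1])%:Z = y]
      `&` [set w | X i.+1 w = b] =
    history i.+1 (fun j => if (j <= i)%N then h j else b)
      `&` [set w | (count_runs_from k c' [seq X j w | j <- iota i.+2 m])%:Z = y'].
  move=> E; rewrite -history_next; apply/seteqP; split=> w.
    by move=> [[H Hc] Xb]; split=> //; apply/E; rewrite -[b]Xb.
  by move=> [[H Xb] Hc]; split=> //; split=> //=; rewrite [X _ w]Xb; apply/E.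
have next b c' y' :
    prob P (history i.+1 (fun j => if (j <= i)%N then h j else b)
      `&` [set w | (count_runs_from k c' [seq X j w | j <- iota i.+2 m])%:Z = y']) =
    prob P (history i h) * (if b then (if h i then alpha else 1 - beta)
      else (if h i then 1 - alpha else beta)) * run_law alpha beta k b c' m y'.
  by rewrite IH ltnn -history_next prob_history_next.
rewrite (swap false 0%N y) // next run_lawS /success_law.
have [ck|ck] := eqVneq c.+1 k.
  rewrite (swap true 0%N (y - 1)) ?next; first ring.
  by move=> s /=; rewrite ck eqxx; split; lia.
rewrite (swap true c.+1 y) ?next; first ring.
by move=> s /=; rewrite (negbTE ck).
Qed.

Lemma runs_pmf_initial_law k m y :
  runs_pmf X k m y = initial_law alpha beta p k m y.
Proof.
case: m => [|m]; rewrite /runs_pmf /num_runs /count_runs.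
  rewrite /=; have [->|y0] := eqVneq y 0.
    by rewrite (_ : [set _ | _] = setT) /prob ?probability_setT//; apply/seteqP.
  rewrite (_ : [set _ | _] = set0) /prob ?measure0//.
  by apply/seteqP; split=> // w /= /esym/eqP; rewrite (negbTE y0).
rewrite (prob_split _ 0%N); last first.
  exact: (measurable_trials (iota 0 m.+1) (fun s => (count_runs_from k 0 s)%:Z = y)).
have swap b c' y' :
    (forall s, (count_runs_from k 0 (b :: s))%:Z = y <->
               (count_runs_from k c' s)%:Z = y') ->
    prob P ([set w | (count_runs_from k 0 [seq X j w | j <- iota 0 m.+1])%:Z = y]
      `&` [set w | X 0%N w = b]) =
    prob P [set w | X 0%N w = b] * run_law alpha beta k b c' m y'.
  (* The history up to index 0 is just the value of the first trial. *)
  move=> E; have := prob_history_runs k m 0 (fun=> b) c' y'.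
  rewrite (_ : history 0 _ = [set w | X 0%N w = b]); last first.
    apply/seteqP; split=> w /=; first exact.
    by move=> Xb [|j].
  move=> <-; congr (prob P _); apply/seteqP; split=> w /=.
    by move=> [H Xb]; split=> //; apply/E; rewrite -Xb.
  by move=> [Xb H]; split=> //; rewrite Xb; apply/E.
rewrite (swap false 0%N y)// (mbt_failure HX) /initial_law /success_law.
have [k1|k1] := eqVneq 1%N k.
  rewrite (swap true 0%N (y - 1)) ?(mbt_success HX)//.
  by move=> s /=; rewrite k1 eqxx; split; lia.
rewrite (swap true 1%N y) ?(mbt_success HX)//.
by move=> s /=; rewrite (negbTE k1).
Qed.

End Chain.

Theorem theorem4p10 (R : realType) (d : measure_display)
    (T : measurableType d) (P : probability T R) (X : nat -> {RV P >-> bool})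
    (p alpha beta : R) (k n x : nat)
    (HX : markov_bernoulli_trials X p alpha beta)
    (hk : (1 <= k)%N) (hn : (k + 2 <= n)%N) :
  let g (m : nat) (y : int) : R := runs_pmf X k m y in
  g n x%:Z =
    (alpha + beta) * g (n - 1)%N x%:Z
    + (1 - alpha - beta) * g (n - 2)%N x%:Z
    + alpha ^+ k * g (n - k)%N (x%:Z - 1)
    - alpha ^+ (k - 1) * (1 - alpha) * (1 - beta) * g (n - k - 1)%N x%:Z
    + alpha ^+ (k - 1) * (1 - alpha - beta - alpha ^+ 2)
        * g (n - k - 1)%N (x%:Z - 1)
    - alpha ^+ k * (1 - alpha - beta) * g (n - k - 2)%N (x%:Z - 1).
Proof.
move=> g; rewrite /g !(runs_pmf_initial_law P X HX).
(* Writing [n] through [m = n - k - 2] removes every truncated subtraction from the indices. *)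
have [m ->] : exists m, n = (m + k).+2 by exists (n - k - 2)%N; lia.
have -> : ((m + k).+2 - 1 = (m + k).+1)%N by lia.
have -> : ((m + k).+2 - 2 = m + k)%N by lia.
have -> : ((m + k).+2 - k = m.+2)%N by lia.
have -> : (m.+2 - 1 = m.+1)%N by lia.
have -> : (m.+2 - 2 = m)%N by lia.
exact: initial_law_rec.
Qed.
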